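(* Let $S$ be a finite set of points in the plane, each colored blue or red. Suppose that there is exactly one monochromatic line $\ell$. Then the two color classes are $S \cap \ell$ and $S \setminus \ell$.
   Context: A line is determined by $S$ if it contains at least two points of $S$; such a line is monochromatic if all points of $S$ on it have the same color. *)

(* Defs.v *)
From mathcomp Require Import all_boot all_order all_algebra.
From mathcomp Require Import all_classical all_reals.

Set Implicit Arguments.
Unset Strict Implicit.
Unset Printing Implicit Defensive.

Import Order.TTheory GRing.Theory Num.Theory.

Local Open Scope classical_set_scope.
Local Open Scope ring_scope.

Definition plane (R : realType) : Type := (R * R)%type.

Definition is_line (R : realType) (L : set (plane R)) : Prop :=
  exists a b c : R, (a, b) <> (0, 0) /\ L = [set p | a * p.1 + b * p.2 = c].

Inductive color := Blue | Red.

(* Colorings are total functions on the plane; only the colors of the points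
   of S are ever inspected. *)
Definition color_class (R : realType) (S : set (plane R))
    (col : plane R -> color) (k : color) : set (plane R) :=
  [set p | S p /\ col p = k].

Definition determined_line (R : realType) (S L : set (plane R)) : Prop :=
  is_line L /\ exists p q, [/\ (S `&` L) p, (S `&` L) q & p <> q].

Definition monochromatic_line (R : realType) (S : set (plane R))
    (col : plane R -> color) (L : set (plane R)) : Prop :=
  determined_line S L /\
  forall p q, (S `&` L) p -> (S `&` L) q -> col p = col q.

(* Main.v *)
Require Import Defs.
From mathcomp Require Import all_boot all_order all_algebra.
From mathcomp Require Import all_classical all_reals.
From mathcomp Require Import ring lra.

(** Lift the points of the plane to vectors of [R^3], so that a point is a
    vector up to a nonzero scalar.  Let [l] carry points of color blue only, say
    [l] is the kernel of the functional [f], and suppose that some blue point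
    lies off [l].  Consider the triples of independent vectors [p, q, r] with
    [p, q] blue, [r] red and [p - q] red, on which [f] takes both a positive and
    a negative value.  The line through [r] and [p - q] has a blue point
    [e = g r + p - q], where [g > 0] up to exchanging [p] and [q].  The values
    of [f] forbid that [p] and [e] both lie on [l], so there is a red point
    [p + n e].  Then [(p, -n e, q - p)] (if [n < 0]) or [(p, -n e, r)] (if
    [n > 0]) is another such triple, which spans a strictly larger convex cone,
    with one more vector [+-s], [s] in [S].  As [S] is finite, this is absurd.

    Dually, this is the descent on triangles of the proof of the Motzkin-Rabin
    theorem; the condition on [f] keeps the triangle away from the point dual
    to [l]. *)

Set Implicit Arguments.
Unset Strict Implicit.
Unset Printing Implicit Defensive.

Import Order.TTheory GRing.Theory Num.Theory.

Local Open Scope classical_set_scope.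
Local Open Scope ring_scope.

Ltac vec_ring := apply/rowP => ?; rewrite !mxE; ring.

(** * Determinants, linear forms and cones in [R^3] *)

Section Vectors.
Variable R : realFieldType.
Implicit Types (p q r u v w f : 'rV[R]_3).

Definition det3 u v w : R :=
  u 0 0 * (v 0 1 * w 0 2%:R - v 0 2%:R * w 0 1)
  - u 0 1 * (v 0 0 * w 0 2%:R - v 0 2%:R * w 0 0)
  + u 0 2%:R * (v 0 0 * w 0 1 - v 0 1 * w 0 0).

Definition dot3 u v : R := u 0 0 * v 0 0 + u 0 1 * v 0 1 + u 0 2%:R * v 0 2%:R.

Lemma dot3D f u v : dot3 f (u + v) = dot3 f u + dot3 f v.
Proof. by rewrite /dot3 !mxE; ring. Qed.

Lemma dot3Z f (a : R) u : dot3 f (a *: u) = a * dot3 f u.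
Proof. by rewrite /dot3 !mxE; ring. Qed.

(** Cramer's linear relation between four vectors of [R^3], paired with [f]. When [f] kills [u] and
    [v], only the term in [det3 t u v] survives on the right, which yields independence of
    [t, u, v]. *)
Lemma cramer3 f t u v w :
  dot3 f t * det3 u v w = dot3 f u * det3 t v w - dot3 f v * det3 t u w
                          + dot3 f w * det3 t u v.
Proof. by rewrite /dot3 /det3; ring. Qed.

Definition cone3 p q r v :=
  exists x y z : R, [/\ 0 <= x, 0 <= y, 0 <= z & v = x *: p + y *: q + z *: r].

Lemma cone3Z p q r v a : 0 <= a -> cone3 p q r v -> cone3 p q r (a *: v).
Proof.
move=> a0 [x [y [z [x0 y0 z0 ->]]]]; exists (a * x), (a * y), (a * z).
by split; rewrite ?mulr_ge0 // !scalerDr !scalerA.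
Qed.

Lemma cone3D p q r u v : cone3 p q r u -> cone3 p q r v -> cone3 p q r (u + v).
Proof.
move=> [x [y [z [x0 y0 z0 ->]]]] [x' [y' [z' [x'0 y'0 z'0 ->]]]].
exists (x + x'), (y + y'), (z + z').
by split; rewrite ?addr_ge0 //; vec_ring.
Qed.

Lemma cone3_swap p q r v : cone3 p q r v -> cone3 q p r v.
Proof.
move=> [x [y [z [x0 y0 z0 ->]]]]; exists y, x, z.
by split=> //; rewrite (addrC (y *: q)).
Qed.

Definition cone3_le p q r p' q' r' :=
  [/\ cone3 p' q' r' p, cone3 p' q' r' q & cone3 p' q' r' r].

Lemma cone3_leP p q r p' q' r' v :
  cone3_le p q r p' q' r' -> cone3 p q r v -> cone3 p' q' r' v.
Proof.
move=> [cp cq cr] [x [y [z [x0 y0 z0 ->]]]].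
by do ![apply: cone3D | apply: cone3Z].
Qed.

Lemma cone3_coords p q r (x y z : R) : det3 p q r != 0 ->
  cone3 p q r (x *: p + y *: q + z *: r) -> 0 <= x /\ 0 <= y.
Proof.
move=> d0 [x' [y' [z' [x'0 y'0 z'0 E]]]].
have Ex : x * det3 p q r = x' * det3 p q r.
  transitivity (det3 (x *: p + y *: q + z *: r) q r);
    [|rewrite E]; rewrite /det3 !mxE; ring.
have Ey : y * det3 p q r = y' * det3 p q r.
  transitivity (det3 p (x *: p + y *: q + z *: r) r);
    [|rewrite E]; rewrite /det3 !mxE; ring.
by rewrite (mulIf d0 Ex) (mulIf d0 Ey).
Qed.

(** Stated negatively so that it passes to larger cones: a form with a weak sign on the generators
    keeps that sign on the whole cone. *)
Definition changes_sign f p q r :=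
  ~ [/\ 0 <= dot3 f p, 0 <= dot3 f q & 0 <= dot3 f r] /\
  ~ [/\ dot3 f p <= 0, dot3 f q <= 0 & dot3 f r <= 0].

Lemma changes_sign_cone3 f p q r p' q' r' :
  cone3_le p q r p' q' r' -> changes_sign f p q r -> changes_sign f p' q' r'.
Proof.
move=> [cp cq cr] [npos nneg]; split=> -[fp fq fr].
  have pos v : cone3 p' q' r' v -> 0 <= dot3 f v.
    move=> [x [y [z [x0 y0 z0 ->]]]].
    by rewrite !dot3D !dot3Z !addr_ge0 // mulr_ge0.
  by apply: npos; split; apply: pos.
have neg v : cone3 p' q' r' v -> dot3 f v <= 0.
  move=> [x [y [z [x0 y0 z0 ->]]]].
  by rewrite !dot3D !dot3Z !ler_wnDl // mulr_ge0_le0.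
by apply: nneg; split; apply: neg.
Qed.

End Vectors.

Lemma count_lt (T : eqType) (a b : pred T) (s : seq T) x :
  subpred a b -> x \in s -> b x -> ~~ a x -> (count a s < count b s)%N.
Proof.
move=> sab; elim: s => //= y s IH; rewrite inE => /predU1P[<- bx nax|xs bx nax].
  by rewrite bx (negbTE nax) add0n add1n ltnS sub_count.
rewrite -addnS leq_add ?IH //.
by case: (boolP (a y)) => // /sab ->.
Qed.

(** * The descent on triples, for abstract colors of vectors *)

Section Descent.
Variable R : realFieldType.
Variables (blue red : 'rV[R]_3 -> Prop) (f : 'rV[R]_3).
Implicit Types (p q r u v w : 'rV[R]_3).

Hypothesis blueZ : forall (a : R) v, a != 0 -> blue v -> blue (a *: v).
Hypothesis redZ : forall (a : R) v, a != 0 -> red v -> red (a *: v).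
(** Independence of [u] and [v] is expressed by a vector [w] that completes them to a basis. *)
Hypothesis red_line : forall u v w, red u -> red v -> det3 u v w != 0 ->
  exists x y : R, [/\ x != 0, y != 0 & blue (x *: u + y *: v)].
Hypothesis blue_line : forall u v w, blue u -> blue v -> det3 u v w != 0 ->
  ~ (dot3 f u = 0 /\ dot3 f v = 0) ->
  exists x y : R, [/\ x != 0, y != 0 & red (x *: u + y *: v)].

Definition good_triple p q r :=
  [/\ blue p, blue q, red r & red (p - q)] /\
  (det3 p q r != 0 /\ changes_sign f p q r).

Definition larger_triple p q r p' q' r' :=
  [/\ good_triple p' q' r', cone3_le p q r p' q' r' &
      exists e, [/\ blue e, cone3 p' q' r' e & ~ cone3 p q r e]].

Lemma good_triple_swap p q r : good_triple p q r -> good_triple q p r.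
Proof.
move=> [[bp bq rr rpq] [d [s1 s2]]]; split; [split => // | split].
- rewrite (_ : q - p = (-1) *: (p - q)); last by vec_ring.
  by apply: redZ => //; rewrite oppr_eq0 oner_eq0.
- rewrite (_ : det3 q p r = - det3 p q r) ?oppr_eq0 //.
  by rewrite /det3; ring.
- by split=> -[? ? ?]; [apply: s1 | apply: s2].
Qed.

Lemma good_triple_step_pos p q r (g : R) : 0 < g -> good_triple p q r ->
  blue (g *: r + p - q) -> exists p' q' r', larger_triple p q r p' q' r'.
Proof.
move=> g0 [[bp bq rr rpq] [d sgn]]; set e := _ - q => be.
have de : det3 p e r != 0.
  rewrite (_ : det3 p e r = - det3 p q r) ?oppr_eq0 //.
  by rewrite /det3 !mxE; ring.
have fe : dot3 f e = g * dot3 f r + dot3 f p - dot3 f q.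
  by rewrite /dot3 !mxE; ring.
(* If [f] kills [p] and [e], then [f q = g f r] with [g > 0], so [f] has a weak sign on the
   triple. *)
have nl : ~ (dot3 f p = 0 /\ dot3 f e = 0).
  move=> [fp0 fe0]; move: fe; rewrite fp0 fe0 => fqr.
  have {fqr} fq : dot3 f q = g * dot3 f r by lra.
  case: sgn => s1 s2; case: (lerP 0 (dot3 f r)) => fr.
    by apply: s1; rewrite fp0 fq mulr_ge0 // ltW.
  by apply: s2; rewrite fp0 fq; split=> //; rewrite ?pmulr_rle0 // ltW.
have [x [y [x0 y0 rxy]]] := blue_line bp be de nl.
pose n := y / x.
have n0 : n != 0 by rewrite mulf_neq0 ?invr_eq0.
have rn : red (p - (- n *: e)).
  rewrite (_ : p - _ = x^-1 *: (x *: p + y *: e)).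
    by apply: redZ; rewrite ?invr_eq0.
  by apply/rowP => i; rewrite !mxE /n; field.
have bn : blue (- n *: e) by apply: blueZ; rewrite ?oppr_eq0.
have gn0 : g != 0 by rewrite gt_eqF.
case: (ltrP n 0) => [n_lt0 | n_ge0].
  exists p, (- n *: e), (q - p).
  (* Here [q = p + (q - p)] and [g r = e + (q - p)], where [e] is [(- n)^-1] times [- n e]. *)
  have cle : cone3_le p q r p (- n *: e) (q - p).
    split.
    - by exists 1, 0, 0; split=> //; vec_ring.
    - by exists 1, 0, 1; split=> //; vec_ring.
    - exists 0, (g^-1 * (- n)^-1), g^-1; split=> //.
      + by rewrite mulr_ge0 // invr_ge0; lra.
      + by rewrite invr_ge0 ltW.
      + rewrite scalerA -mulrA mulVf ?oppr_eq0 // mulr1 scale0r add0r.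
        rewrite -scalerDr (_ : e + _ = g *: r); last by vec_ring.
        by rewrite scalerA mulVf // scale1r.
  split=> //; last first.
    exists (- n *: e); split=> //; first by exists 0, 1, 0; split=> //; vec_ring.
    (* The [q]-coordinate [n] is negative, so the new vector lies outside the old cone. *)
    rewrite (_ : - n *: e = - n *: p + n *: q + (- n * g) *: r);
      last by vec_ring.
    by case/(cone3_coords d); lra.
  split; [split=> // | split].
  - rewrite (_ : q - p = (-1) *: (p - q)); last by vec_ring.
    by apply: redZ => //; rewrite oppr_eq0 oner_eq0.
  - rewrite (_ : det3 _ _ _ = n * g * det3 p q r);
      last by rewrite /det3 !mxE; ring.
    by rewrite (mulf_neq0 (mulf_neq0 n0 gn0)).
  - exact: changes_sign_cone3 cle sgn.
have n_gt0 : 0 < n by rewrite lt_neqAle eq_sym n0.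
exists p, (- n *: e), r.
(* Here [q = p - e + g r], and [- e] is [n^-1] times [- n e]. *)
have cle : cone3_le p q r p (- n *: e) r.
  split.
  - by exists 1, 0, 0; split=> //; vec_ring.
  - exists 1, n^-1, g; split=> //; rewrite ?invr_ge0 ?(ltW g0) //.
    rewrite scalerA mulrN mulVf //; vec_ring.
  - by exists 0, 0, 1; split=> //; vec_ring.
split=> //; last first.
  exists (- n *: e); split=> //; first by exists 0, 1, 0; split=> //; vec_ring.
  (* Now the [p]-coordinate [- n] is the negative one. *)
  rewrite (_ : - n *: e = - n *: p + n *: q + (- n * g) *: r);
    last by vec_ring.
  by case/(cone3_coords d); lra.
split; [split=> // | split].
- rewrite (_ : det3 _ _ _ = n * det3 p q r); last by rewrite /det3 !mxE; ring.
  exact: mulf_neq0.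
- exact: changes_sign_cone3 cle sgn.
Qed.

Lemma good_triple_step p q r :
  good_triple p q r -> exists p' q' r', larger_triple p q r p' q' r'.
Proof.
move=> gd; have [[bp bq rr rpq] [d sgn]] := gd.
have ds : det3 r (p - q) p != 0.
  by rewrite (_ : det3 _ _ _ = det3 p q r) // /det3 !mxE; ring.
have [x [y [x0 y0 bxy]]] := red_line rr rpq ds.
have g0 : x / y != 0 by rewrite mulf_neq0 ?invr_eq0.
have be : blue ((x / y) *: r + p - q).
  rewrite (_ : _ - q = y^-1 *: (x *: r + y *: (p - q))).
    by apply: blueZ; rewrite ?invr_eq0.
  by rewrite scalerDr !scalerA mulVf // scale1r (mulrC x) addrA.
(* When [x / y < 0], the opposite blue vector [- (x / y) r + q - p] has the required form with [p]
   and [q] exchanged. *)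
case: (ltrgtP (x / y) 0) g0 => // [g_lt0 | g_gt0] _; last first.
  exact: good_triple_step_pos g_gt0 gd be.
have [] := @good_triple_step_pos q p r (- (x / y)).
- by rewrite oppr_gt0.
- exact: good_triple_swap.
- rewrite (_ : _ - p = (-1) *: ((x / y) *: r + p - q)); last by vec_ring.
  by apply: blueZ; rewrite ?oppr_eq0 ?oner_eq0.
move=> p' [q' [r' [gd' [cq cp cr] [e [be' ce nce]]]]].
exists p', q', r'; split=> //; exists e; split=> //.
by move/cone3_swap.
Qed.

(** Each step brings a new blue vector into the cone, hence also its positive multiple in [X]; the
    number of members of [X] in the cone would grow forever. *)
Lemma no_good_triple (X : seq ('rV[R]_3)) :
  (forall v, blue v -> exists2 a, 0 < a & a *: v \in X) ->
  forall p q r, ~ good_triple p q r.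
Proof.
move=> Xblue p q r.
pose N p q r := count (fun v => `[< cone3 p q r v >]) X.
(* Induction on a bound for the number of members of [X] outside the cone. *)
move: {2}(size X - N p q r)%N (leqnn (size X - N p q r)) => n.
elim: n p q r => [|n IH] p q r le_n gd;
  have [p' [q' [r' [gd' cle [e [be ce nce]]]]]] := good_triple_step gd;
  have [a a0 aX] := Xblue _ be.
all: have lt_N : (N p q r < N p' q' r')%N.
1,3: apply: (count_lt _ aX) => [v /asboolP cv||].
1,4: by apply/asboolP; exact: cone3_leP cle cv.
1,3: by apply/asboolP; exact: cone3Z (ltW a0) ce.
1,2: apply/asboolPn => /(@cone3Z _ _ _ _ _ a^-1).
1,2: by rewrite scalerA mulVf ?gt_eqF // scale1r invr_ge0 => /(_ (ltW a0)).
all: have le_N : (N p' q' r' <= size X)%N by exact: count_size.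
- by move: le_n; rewrite leqn0 subn_eq0 leqNgt (leq_trans lt_N).
- apply: (IH _ _ _ _ gd'); rewrite -ltnS; apply: leq_trans le_n.
  by rewrite ltn_sub2l // (leq_trans lt_N).
Qed.

End Descent.

(** * Homogeneous coordinates and lines of the plane *)

Section Lift.
Variable R : realType.
Implicit Types (p q t : plane R) (L : set (plane R)).

(* The third coordinate 1 is the default value of [nth]. *)
Definition hom_coords p : 'rV[R]_3 := \row_(i < 3) nth 1 [:: p.1; p.2] i.

Lemma line_through p q : p <> q -> exists L,
  [/\ is_line L, L p, L q & forall t, L t ->
      exists x y : R, hom_coords t = x *: hom_coords p + y *: hom_coords q].
Proof.
case: p q => [p1 p2] [q1 q2] pq.
exists [set t | (p2 - q2) * t.1 + (q1 - p1) * t.2 = q1 * p2 - p1 * q2].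
split => /=; [|ring|ring|].
  exists (p2 - q2), (q1 - p1), (q1 * p2 - p1 * q2); split=> // -[e1 e2].
  by apply: pq; congr (_, _); lra.
have hom_coordsE (x y : R) (t : plane R) : x + y = 1 ->
    t.1 = x * p1 + y * q1 -> t.2 = x * p2 + y * q2 ->
    hom_coords t = x *: hom_coords (p1, p2) + y *: hom_coords (q1, q2).
  move=> xy e1 e2; apply/rowP => i; rewrite !mxE.
  by case: i => [[|[|[|//]]] ?] /=; rewrite ?mulr1.
case=> t1 t2 /= E.
(* The affine parameter of [t] is read off the second coordinate on a vertical line, off the first
   one otherwise. *)
have [e1|n1] := eqVneq (q1 - p1) 0.
  have n2 : q2 - p2 != 0.
    by apply/eqP => e2; apply: pq; congr (_, _); lra.
  exists (1 - (t2 - p2) / (q2 - p2)), ((t2 - p2) / (q2 - p2)).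
  apply: hom_coordsE => /=; [by field | | by field].
  have q1E : q1 = p1 by lra.
  rewrite q1E -mulrDl subrK mul1r; apply: (mulfI n2).
  by move: E; rewrite q1E; lra.
exists (1 - (t1 - p1) / (q1 - p1)), ((t1 - p1) / (q1 - p1)).
apply: hom_coordsE => /=; [by field | by field |].
apply: (mulfI n1).
transitivity ((q1 - p1) * p2 + (t1 - p1) * (q2 - p2)); last by field.
by lra.
Qed.

Lemma hom_coords_scale_inj p q (a : R) : hom_coords p = a *: hom_coords q -> p = q.
Proof.
move=> E; have a1 : a = 1.
  by have /rowP /(_ 2%:R) := E; rewrite !mxE /= mulr1.
move: E; rewrite a1 scale1r => /rowP E.
have := E 0; have := E 1; rewrite !mxE /=.
by case: p q {E} => [? ?] [? ?] /= -> ->.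
Qed.

Lemma hom_coords_indep p q :
  p <> q -> exists w, det3 (hom_coords p) (hom_coords q) w != 0.
Proof.
case: p q => [p1 p2] [q1 q2] pq.
have [e1|n1] := eqVneq p1 q1.
  (* The basis vector [(1, 0, 0)] gives determinant [p2 - q2]; below, [(0, 1, 0)] gives
     [q1 - p1]. *)
  exists (\row_i nth 0 [:: 1] i); rewrite /det3 !mxE /=.
  have n2 : p2 - q2 != 0.
    by rewrite subr_eq0; apply/eqP => e2; apply: pq; rewrite e1 e2.
  by apply: contraNneq n2 => E; apply/eqP; lra.
exists (\row_i nth 0 [:: 0; 1] i); rewrite /det3 !mxE /=.
by apply: contraNneq n1 => E; apply/eqP; lra.
Qed.

(** Source of both [red_line] and [blue_line]. A zero coefficient would make [t] equal to [p] or
    [q], which have the other color. *)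
Lemma other_color_on_line (S : set (plane R)) (col : plane R -> color)
    p q (a b : R) w :
  S p -> S q -> col p = col q -> a != 0 -> b != 0 ->
  det3 (a *: hom_coords p) (b *: hom_coords q) w != 0 ->
  (forall L, monochromatic_line S col L -> L p -> L q -> False) ->
  exists t x y, [/\ S t, col t <> col p, x != 0, y != 0 &
    hom_coords t = x *: (a *: hom_coords p) + y *: (b *: hom_coords q)].
Proof.
move=> Sp Sq cpq a0 b0 d nomono.
have pq : p <> q.
  by move=> pq; move: d; rewrite pq /det3 !mxE => /eqP[]; ring.
have [L [Ll Lp Lq Lt]] := line_through pq.
have [t [St Ltt ct]] : exists t, [/\ S t, L t & col t <> col p].
  apply: contrapT => nt; apply: (nomono L _ Lp Lq).
  have same t : (S `&` L) t -> col t = col p.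
    by move=> [St Ltt]; apply: contrapT => ct; apply: nt; exists t.
  by split=> [|u v /same -> /same ->]; first by split=> //; exists p, q.
have [x [y E]] := Lt _ Ltt.
have x0 : x != 0.
  apply/eqP => x0; apply: ct; rewrite cpq; congr col.
  by apply: (@hom_coords_scale_inj _ _ y); rewrite E x0 scale0r add0r.
have y0 : y != 0.
  apply/eqP => y0; apply: ct; congr col.
  by apply: (@hom_coords_scale_inj _ _ x); rewrite E y0 scale0r addr0.
exists t, (x / a), (y / b); split; rewrite ?mulf_neq0 ?invr_eq0 //.
by rewrite !scalerA !divfK.
Qed.

End Lift.

(** * The initial triple and the conclusion *)

Lemma same_color_on_line (R : realType) (S : set (plane R))
    (col : plane R -> color) (l : set (plane R)) (p0 b : plane R) :
  finite_set S -> monochromatic_line S col l ->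
  (forall m, monochromatic_line S col m -> m = l) ->
  S p0 -> l p0 -> S b -> col b = col p0 -> l b.
Proof.
move=> /finite_seqP[s Ss] [[[lx [ly [lc [_ lE]]]] [v1 [v2 v12]]] mono] luniq.
move=> S0 l0 Sb cb; have {v12} [[S1 l1] [S2 l2] v12] := v12.
(* The default value [- lc] is the third coordinate, so that [l] is the kernel of [f]. *)
pose f : 'rV[R]_3 := \row_i nth (- lc) [:: lx; ly] i.
have fE t : dot3 f (hom_coords t) = lx * t.1 + ly * t.2 - lc.
  by rewrite /dot3 !mxE /= mulr1.
have lP t : l t <-> dot3 f (hom_coords t) = 0.
  rewrite fE lE /=; split=> [->|/eqP]; first by rewrite subrr.
  by rewrite subr_eq0 => /eqP.
apply: contrapT => nlb.
(* Negative multiples count as well, so that only the projective point matters. *)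
pose lift (K : color -> Prop) (v : 'rV[R]_3) := exists p (a : R),
  [/\ S p, K (col p), a != 0 & v = a *: hom_coords p].
pose blue := lift (fun c => c = col p0).
pose red := lift (fun c => c <> col p0).
have liftZ K (a : R) v : a != 0 -> lift K v -> lift K (a *: v).
  move=> a0 [p [a' [Sp Kp a'0 ->]]]; exists p, (a * a').
  by rewrite mulf_neq0 // scalerA.
have colE (c c' d : color) : c <> d -> c' <> d -> c = c'.
  by case: c; case: c'; case: d.
have red_line u v w : red u -> red v -> det3 u v w != 0 ->
    exists x y : R, [/\ x != 0, y != 0 & blue (x *: u + y *: v)].
  move=> [p [a [Sp cp a0 ->]]] [q [a' [Sq cq a'0 ->]]] d.
  have cpq : col p = col q by exact: colE cp cq.
  have [|t [x [y [St ct x0 y0 E]]]] := other_color_on_line Sp Sq cpq a0 a'0 d.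
    (* A line through the red point [p] is not [l], whose points in [S] all have the color of
       [p0]. *)
    by move=> L /luniq -> lp _; apply: cp; apply: mono.
  exists x, y; split=> //; exists t, 1.
  rewrite scale1r oner_eq0; split=> //.
  by move: ct cp; case: (col t); case: (col p); case: (col p0).
have blue_line u v w : blue u -> blue v -> det3 u v w != 0 ->
    ~ (dot3 f u = 0 /\ dot3 f v = 0) ->
    exists x y : R, [/\ x != 0, y != 0 & red (x *: u + y *: v)].
  move=> [p [a [Sp cp a0 ->]]] [q [a' [Sq cq a'0 ->]]] d nf.
  have cpq : col p = col q by rewrite cp.
  have [|t [x [y [St ct x0 y0 E]]]] := other_color_on_line Sp Sq cpq a0 a'0 d.
    move=> L /luniq -> /lP fp /lP fq; apply: nf.
    by rewrite !dot3Z fp fq !mulr0.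
  exists x, y; split=> //; exists t, 1.
  by rewrite scale1r oner_eq0; split; rewrite // -cp.
have blue1 p : S p -> col p = col p0 -> blue (hom_coords p).
  by move=> Sp cp; exists p, 1; rewrite scale1r oner_eq0.
have bb := blue1 _ Sb cb.
have b1 : blue (hom_coords v1) by apply: blue1 => //; apply: mono.
have b2 : blue (hom_coords v2) by apply: blue1 => //; apply: mono.
have f1 := (lP v1).1 l1; have f2 := (lP v2).1 l2.
have fb0 : dot3 f (hom_coords b) != 0 by apply/eqP => /lP.
have db : det3 (hom_coords b) (hom_coords v1) (hom_coords v2) != 0.
  have [w dw] := hom_coords_indep v12.
  have := cramer3 f (hom_coords b) (hom_coords v1) (hom_coords v2) w.
  rewrite f1 f2 !mul0r subrr add0r => E.
  have : dot3 f (hom_coords b) * det3 (hom_coords v1) (hom_coords v2) w != 0.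
    by rewrite mulf_neq0.
  by rewrite E; apply: contraNneq => ->; rewrite mulr0.
(* The lines joining [b], which is off [l], to [v1] and to [v2] differ from [l], so each carries a
   red point. *)
have [x [y [x0 y0 r1]]] : exists x y : R,
    [/\ x != 0, y != 0 & red (x *: hom_coords v1 + y *: hom_coords b)].
  apply: (blue_line _ _ (hom_coords v2)) => //; last by case=> _ /eqP; apply/negP.
  rewrite -oppr_eq0; move: db; congr (_ != 0).
  by rewrite /det3; ring.
have [x' [y' [x'0 y'0 r2]]] : exists x y : R,
    [/\ x != 0, y != 0 & red (x *: hom_coords v2 + y *: hom_coords b)].
  apply: (blue_line _ _ (hom_coords v1)) => //; last by case=> _ /eqP; apply/negP.
  move: db; congr (_ != 0).
  by rewrite /det3; ring.
pose p := x *: hom_coords v1; pose q := - y *: hom_coords b.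
pose r := (y * y') *: (x' *: hom_coords v2 + y' *: hom_coords b).
pose X := [seq hom_coords t | t <- s] ++ [seq - hom_coords t | t <- s].
apply: (@no_good_triple _ blue red f _ _ red_line blue_line X _ p q r);
  [exact: liftZ | exact: liftZ | | split; [split | split]].
- move=> _ [t [a [St _ a0 ->]]].
  have ts : t \in s by move: St; rewrite Ss.
  case: (ltrgtP a 0) a0 => // [a_lt0|a_gt0] _.
    exists (- a)^-1; first by rewrite invr_gt0 oppr_gt0.
    rewrite mem_cat scalerA invrN mulNr mulVf ?lt_eqF // scaleN1r.
    by rewrite [X in _ || X]map_f ?orbT.
  exists a^-1; first by rewrite invr_gt0.
  by rewrite mem_cat scalerA mulVf ?gt_eqF // scale1r map_f.
- exact: liftZ.
- by apply: liftZ; rewrite ?oppr_eq0.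
- by apply: liftZ; rewrite ?mulf_neq0.
- by rewrite /p /q scaleNr opprK.
- rewrite (_ : det3 p q r = x * y * (y * y') * x' *
    det3 (hom_coords b) (hom_coords v1) (hom_coords v2)); last by rewrite /det3 !mxE; ring.
  by rewrite !mulf_neq0.
- have fqr : dot3 f q * dot3 f r < 0.
    rewrite /q /r !(dot3Z, dot3D) f2 mulr0 add0r.
    rewrite (_ : _ * _ = - (y * y' * dot3 f (hom_coords b)) ^+ 2); last by ring.
    by rewrite oppr_lt0 exprn_even_gt0 //= !mulf_neq0.
  split=> -[_ fq fr]; move: fqr; apply/negP; rewrite -leNgt.
    exact: mulr_ge0.
  exact: mulr_le0.
Qed.

Theorem theorem2p11 (R : realType) (S : set (plane R))
    (col : plane R -> color) (l : set (plane R))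
    (Sfin : finite_set S)
    (lmono : monochromatic_line S col l)
    (luniq : forall m : set (plane R), monochromatic_line S col m -> m = l) :
  (color_class S col Blue = S `&` l /\ color_class S col Red = S `\` l) \/
  (color_class S col Red = S `&` l /\ color_class S col Blue = S `\` l).
Proof.
have [[_ [p0 [_ [[S0 l0] _ _]]]] mono] := lmono.
have lP p : S p -> l p <-> col p = col p0.
  move=> Sp; split=> [lp|]; first exact: mono.
  exact: same_color_on_line Sfin lmono luniq S0 l0 Sp.
case E: (col p0) in lP *; [left | right].
all: split; apply/seteqP; split=> p /= [Sp cp]; split=> //.
all: have lp := lP p Sp.
1,5: exact/lp.
1,4: exact/lp.
1,3: by move/lp; rewrite cp.
all: by case cE: (col p) => //; case: cp; apply/lp.
Qed.
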